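(* Let $(\Omega,\mathfrak{F},\mathbb{P})$ be a probability space and let $u_i,u_j:\Omega\to\mathbb{R}$ be real random variables with finite variances and with $\mathbb{E}\big[(u_i-\mathbb{E}u_i)^2(u_j-\mathbb{E}u_j)^2\big]<\infty$. Let $N>3$ be an integer and let $(u_i(\omega_k),u_j(\omega_k))$, $k=1,\dots,N$, be $N$ independent samples of the pair $(u_i,u_j)$. For non-negative integers $a,b$ let $$s_{a,b}=\sum_{k=1}^{N}u_i(\omega_k)^a\,u_j(\omega_k)^b ,$$ and let $$\widehat{h}_{1,1}=\frac{N s_{1,1}-s_{0,1}s_{1,0}}{(N-1)N}$$ be the Monte Carlo covariance estimator. Define $$\begin{aligned}\widehat{V}=\frac{1}{(N-3)(N-2)(N-1)^2N^2}\Big(&N\big[(-N^2+N+2)s_{1,1}^2+(N-1)^2\,(N s_{2,2}-2s_{1,0}s_{1,2})+(N-1)s_{0,2}\,(s_{1,0}^2-s_{2,0})\big]\\&+s_{0,1}^2\big[(6-4N)s_{1,0}^2+(N-1)N s_{2,0}\big]\\&-2N s_{0,1}\big[(N-1)^2 s_{2,1}+(5-3N)s_{1,0}s_{1,1}\big]\Big).\end{aligned}$$ Then $\widehat{V}$ is an unbiased estimator of the variance (sampling error) of $\widehat{h}_{1,1}$, that is, $$\mathbb{E}(\widehat{V})=\mathrm{Var}(\widehat{h}_{1,1}).$$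
   Context: ''$N$ independent samples of the pair'' means independent, identically distributed copies of the random vector $(u_i,u_j)$; the two components of one sample are in general dependent. In the motivating application $u_i,u_j$ are the values at two spatial points $x_i,x_j$ of a discretized random solution field $u^h(x,\omega)$. $\mathrm{Var}(Z)=\mathbb{E}((Z-\mathbb{E}Z)^2)$. *)

(* Defs.v *)
From HB Require Import structures.
From mathcomp Require Import all_boot all_order all_algebra.
From mathcomp Require Import all_classical all_reals all_analysis.

Set Implicit Arguments.
Unset Strict Implicit.
Unset Printing Implicit Defensive.

Import Order.TTheory GRing.Theory Num.Theory.
Import numFieldNormedType.Exports.

Local Open Scope classical_set_scope.
Local Open Scope ring_scope.

Definition rpair (S A B : Type) (X : S -> A) (Y : S -> B) : S -> A * B :=
  fun w => (X w, Y w).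

Definition mutually_independent (d d' : measure_display)
    (S : measurableType d) (E : measurableType d') (R : realType)
    (Q : probability S R) (I : finType) (Z : I -> S -> E) : Prop :=
  forall (J : {set I}) (A : I -> set E),
    (forall k, measurable (A k)) ->
    Q (\bigcap_(k in [set` J]) (Z k @^-1` A k))
    = (\prod_(k in J) Q (Z k @^-1` A k))%E.

(* Z and Z' may live on different probability spaces; the laws are compared on
   measurable sets only. *)
Definition same_law (d1 d2 d' : measure_display)
    (S1 : measurableType d1) (S2 : measurableType d2) (E : measurableType d')
    (R : realType) (P1 : probability S1 R) (P2 : probability S2 R)
    (Z : S1 -> E) (Z' : S2 -> E) : Prop :=
  forall A : set E, measurable A -> P1 (Z @^-1` A) = P2 (Z' @^-1` A).

(* (X k, Y k), k < N, are N independent samples of the pair (u, v).  Independence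
   is between different k only: X k and Y k may be dependent.  The samples are
   carried by a space (S, Q) of their own, e.g. the N-fold product of (T, P),
   since (T, P) itself may be too small to carry N independent copies. *)
Definition independent_samples (d d' : measure_display)
    (T : measurableType d) (S : measurableType d') (R : realType)
    (P : probability T R) (u v : {RV P >-> R})
    (Q : probability S R) (N : nat) (X Y : 'I_N -> {RV Q >-> R}) : Prop :=
  (forall k, same_law Q P (rpair (X k) (Y k)) (rpair u v)) /\
  mutually_independent Q (fun k => rpair (X k) (Y k)).

Section Estimators.
Context (R : realType) (N : nat) (x y : 'I_N -> R).

Definition power_sum (a b : nat) : R := \sum_(k < N) x k ^+ a * y k ^+ b.

Local Notation n := (N%:R : R).
Local Notation "'s_(' a , b )" := (power_sum a b) (format "'s_(' a ,  b )").

Definition cov_estimator : R :=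
  (n * s_(1, 1) - s_(0, 1) * s_(1, 0)) / ((n - 1) * n).

Definition cov_variance_estimator : R :=
  1 / ((n - 3) * (n - 2) * (n - 1) ^+ 2 * n ^+ 2) *
  (n * ((- n ^+ 2 + n + 2) * s_(1, 1) ^+ 2
        + (n - 1) ^+ 2 * (n * s_(2, 2) - 2 * s_(1, 0) * s_(1, 2))
        + (n - 1) * s_(0, 2) * (s_(1, 0) ^+ 2 - s_(2, 0)))
   + s_(0, 1) ^+ 2 * ((6 - 4 * n) * s_(1, 0) ^+ 2 + (n - 1) * n * s_(2, 0))
   - 2 * n * s_(0, 1) * ((n - 1) ^+ 2 * s_(2, 1)
                         + (5 - 3 * n) * s_(1, 0) * s_(1, 1))).

End Estimators.

(* 'E_Q is a total, extended-real valued operation; integrability of V makes it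
   a genuine expectation, and the equation one between finite numbers. *)
Definition unbiased_estimator (d : measure_display) (S : measurableType d)
    (R : realType) (Q : probability S R) (V : S -> R) (theta : \bar R) : Prop :=
  V \in Lfun Q 1%E /\ ('E_Q[V] = theta)%E.

(* Main.v *)
Require Import Defs.
From HB Require Import structures.
From mathcomp Require Import all_boot all_order all_algebra.
From mathcomp Require Import all_classical all_reals all_analysis.
From mathcomp Require Import measurable_realfun ring lra.

Set Implicit Arguments.
Unset Strict Implicit.
Unset Printing Implicit Defensive.

Import Order.TTheory GRing.Theory Num.Theory.
Import numFieldNormedType.Exports.

Local Open Scope classical_set_scope.
Local Open Scope ring_scope.

(** Both estimators are invariant under x_k -> x_k - s and y_k -> y_k - t
    ([cov_estimator_shift], [cov_variance_estimator_shift]), so the samples may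
    be assumed centered.  For centered independent pairs with
    a = E x^2, b = E y^2, c = E xy, m = E x^2 y^2, the mean of
    x_i x_j y_k y_l vanishes as soon as one index differs from the three others,
    and the surviving index patterns are collected in one formula,
    [mixed_moment]: the Isserlis (Wick) sum over the three pairings of the four
    factors, plus a correction m - ab - 2c^2 supported on i = j = k = l
    ([has_mean_mixed]).

    Every monomial in power sums that occurs in the variance estimator, or in
    the square of the covariance estimator, is a sum of x_i x_j y_k y_l over all
    quadruples with some indices identified.  Its mean is therefore a sum of
    products of Kronecker deltas, a polynomial in N, and both sides of the
    theorem come out as (m + ab / (N-1) - c^2 (N-2) / (N-1)) / N
    ([has_mean_cov_variance_estimator], [variance_cov_estimator]).

    The probabilistic input is the product rule E (f(Z_i) W) = E f(Z_i) E W for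
    W depending only on the samples other than Z_i ([has_mean_restM]).
    Integrability never needs more than the second moments and E x^2 y^2: every
    product of three or four centered factors that occurs is either dominated by
    quantities of the form x_i^2 y_k^2, x_j^2, y_l^2, or is a product of
    independent integrable factors. *)

(** * Integrable functions with a prescribed mean *)

(** Integrability and the value of the integral travel together, so that each
    linear combination of means justifies its own integrability. *)
Definition has_mean (d : measure_display) (S : measurableType d) (R : realType)
    (Q : probability S R) (f : S -> R) (m : R) : Prop :=
  Q.-integrable setT (EFin \o f) /\ (\int[Q]_w (f w)%:E)%E = m%:E.

Section HasMean.
Context (d : measure_display) (S : measurableType d) (R : realType)
  (Q : probability S R).
Implicit Types (f g : S -> R) (a b c : R).

Lemma has_mean_integrable f :
  Q.-integrable setT (EFin \o f) -> has_mean Q f (fine (\int[Q]_w (f w)%:E)%E).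
Proof. by move=> fi; split=> //; rewrite fineK// integrable_fin_num. Qed.

Lemma has_mean_measurable f a : has_mean Q f a -> measurable_fun setT f.
Proof. by case=> /integrableP[/measurable_EFinP]. Qed.

Lemma has_mean_ge0_lty f : measurable_fun setT f -> (forall w, 0 <= f w) ->
  ('E_Q[f] < +oo)%E -> exists a, has_mean Q f a.
Proof.
move=> mf f0; rewrite unlock => foo; eexists; apply: has_mean_integrable.
apply/integrableP; split; first exact/measurable_EFinP.
by under eq_integral do rewrite /= ger0_norm//.
Qed.

Lemma has_mean_dominated f g a : measurable_fun setT g ->
  (forall w, `|g w| <= f w) -> has_mean Q f a -> exists b, has_mean Q g b.
Proof.
move=> mg gf [fi _]; eexists; apply: has_mean_integrable.
apply: (le_integrable measurableT _ _ fi); first exact/measurable_EFinP.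
by move=> w _ /=; rewrite lee_fin (le_trans (gf w))// ler_norm.
Qed.

Lemma eq_has_mean f g a b :
  f =1 g -> a = b -> has_mean Q f a -> has_mean Q g b.
Proof. by move=> /funext-> ->. Qed.

Lemma has_mean_cst a : has_mean Q (fun=> a) a.
Proof.
split; first by apply: finite_measure_integrable_cst.
by have := expectation_cst Q a; rewrite unlock.
Qed.

Lemma has_meanD f g a b :
  has_mean Q f a -> has_mean Q g b -> has_mean Q (fun w => f w + g w) (a + b).
Proof.
move=> [fi fa] [gi gb]; split; first exact: (integrableD measurableT fi gi).
by rewrite (integralD_EFin measurableT fi gi) /= fa gb.
Qed.

Lemma has_meanZ c f a : has_mean Q f a -> has_mean Q (fun w => c * f w) (c * a).
Proof.
move=> [fi fa]; split; first exact: (integrableZl measurableT c fi).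
by rewrite (integralZl measurableT fi c) /= fa.
Qed.

Lemma has_meanB f g a b :
  has_mean Q f a -> has_mean Q g b -> has_mean Q (fun w => f w - g w) (a - b).
Proof.
move=> fa /(has_meanZ (-1)) gb.
by apply: eq_has_mean (has_meanD fa gb) => [w|]; rewrite mulN1r.
Qed.

Lemma has_mean_sum (I : Type) (r : seq I) (F : I -> S -> R) (A : I -> R) :
  (forall i, has_mean Q (F i) (A i)) ->
  has_mean Q (fun w => \sum_(i <- r) F i w) (\sum_(i <- r) A i).
Proof.
move=> FA; elim: r => [|i r IHr].
  by apply: eq_has_mean (has_mean_cst 0) => [w|]; rewrite big_nil.
by apply: eq_has_mean (has_meanD (FA i) IHr) => [w|]; rewrite big_cons.
Qed.

Lemma unbiased_has_mean f a : has_mean Q f a -> unbiased_estimator Q f a%:E.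
Proof. by case=> fi fa; split; [apply/Lfun1_integrable | rewrite unlock]. Qed.

Lemma variance_has_mean f a b : has_mean Q f a ->
  has_mean Q (fun w => f w ^+ 2) b -> 'V_Q[f]%E = (b - a ^+ 2)%:E.
Proof.
move=> fa f2b; have Ef : fine 'E_Q[f] = a by rewrite unlock; case: fa => _ ->.
rewrite /variance unlock Ef.
have [_ <-] : has_mean Q (fun w => (f w - a) * (f w - a)) (b - a ^+ 2).
  apply: eq_has_mean (has_meanD f2b
    (has_meanD (has_meanZ (- 2 * a) fa) (has_mean_cst (a ^+ 2)))) => [w|]; ring.
by rewrite unlock.
Qed.

End HasMean.

(** The two pushforward measures are compared on measurable sets only, which is
    enough for their integrals to coincide; integrability is transferred first,
    through the integral of the absolute value. *)
Lemma has_mean_same_law (d1 d2 d' : measure_display) (S1 : measurableType d1)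
    (S2 : measurableType d2) (E : measurableType d') (R : realType)
    (P1 : probability S1 R) (P2 : probability S2 R)
    (Z1 : S1 -> E) (Z2 : S2 -> E) (f : E -> R) (a : R) :
  measurable_fun setT Z1 -> measurable_fun setT Z2 -> measurable_fun setT f ->
  same_law P1 P2 Z1 Z2 -> has_mean P2 (f \o Z2) a -> has_mean P1 (f \o Z1) a.
Proof.
move=> mZ1 mZ2 mf law12 [fi2 fa].
have mEf : measurable_fun setT (EFin \o f) by exact/measurable_EFinP.
have lawE (g : E -> \bar R) : (\int[pushforward P1 Z1]_z g z =
    \int[pushforward P2 Z2]_z g z)%E.
  by apply: eq_measure_integral => A mA _; exact: law12.
have fi1 : P1.-integrable setT (EFin \o f \o Z1).
  apply/integrableP; split; first exact: measurableT_comp.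
  have mabs : measurable_fun setT (abse \o (EFin \o f)).
    exact: measurableT_comp.
  have abs_ge0 : {in setT, forall z, (0 <= (abse \o (EFin \o f)) z)%E}.
    by move=> z _; exact: abse_ge0.
  have := ge0_integral_pushforward mZ1 P1 measurableT mabs abs_ge0.
  rewrite lawE (ge0_integral_pushforward mZ2 P2 measurableT mabs abs_ge0).
  by move=> /= <-; case/integrableP: fi2.
split=> //.
rewrite -(integral_pushforward mZ1 (D := setT) mEf fi1 measurableT) lawE.
by rewrite (integral_pushforward mZ2 (D := setT) mEf fi2 measurableT).
Qed.

(** * Products of independent random variables *)

Section IndependentProduct.
Context (d : measure_display) (S : measurableType d) (R : realType)
  (Q : probability S R).

(** Independence says that the joint law of f and g is the product of their
    laws, because the two agree on rectangles.  Tonelli then gives the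
    integrability of the product, and Fubini its mean. *)
Lemma has_mean_indepM (f g : S -> R) (a b : R) :
  (forall A B : set R, measurable A -> measurable B ->
    Q (f @^-1` A `&` g @^-1` B) = Q (f @^-1` A) * Q (g @^-1` B))%E ->
  has_mean Q f a -> has_mean Q g b -> has_mean Q (fun w => f w * g w) (a * b).
Proof.
move=> indep fa gb.
pose fM : {mfun S >-> R} := HB.pack f
  (isMeasurableFun.Build _ _ _ _ _ (has_mean_measurable fa)).
pose gM : {mfun S >-> R} := HB.pack g
  (isMeasurableFun.Build _ _ _ _ _ (has_mean_measurable gb)).
pose h : S -> R * R := fun w => (f w, g w).
have mh : measurable_fun setT h.
  exact: measurable_fun_pair (has_mean_measurable fa) (has_mean_measurable gb).
pose hM : {mfun S >-> (R * R)%type} := HB.pack h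
  (isMeasurableFun.Build _ _ _ _ _ mh).
have joint (F : R * R -> \bar R) : (\int[distribution Q hM]_z F z =
    \int[distribution Q fM \x distribution Q gM]_z F z)%E.
  apply: eq_measure_integral => X mX _; apply/esym.
  by apply: product_measure_unique => // A B mA mB; exact: indep.
pose p (z : R * R) : \bar R := (z.1 * z.2)%:E.
have mp : measurable_fun setT p.
  by apply/measurable_EFinP; apply: measurable_funM;
    [exact: measurable_fst | exact: measurable_snd].
have mabs : measurable_fun setT (abse \o p) by exact: measurableT_comp.
have mEFin : measurable_fun setT (EFin : R -> \bar R) by exact/measurable_EFinP.
have idi (u : {mfun S >-> R}) (c : R) : has_mean Q u c ->
    [/\ (distribution Q u).-integrable setT EFin,
      (\int[distribution Q u]_x x%:E = c%:E)%E &
      (\int[distribution Q u]_x (`|x|)%:E \is a fin_num)%E].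
  move=> [ui uc]; have ui' : (distribution Q u).-integrable setT EFin.
    by apply: (integrable_pushforward _ (D := setT)).
  split=> //; first by rewrite (integral_pushforward _ (D := setT)).
  apply: (integrable_fin_num measurableT).
  exact: (integrable_abse ui').
have [fi fE fabs] := idi fM a fa; have [gi gE gabs] := idi gM b gb.
have pi : (distribution Q fM \x distribution Q gM)%E.-integrable setT p.
  apply: (@integrable12ltyP _ _ _ _ R
    (distribution Q fM) (distribution Q gM) p mp).2.
  under eq_integral => x _.
    under eq_integral do rewrite /p /= normrM EFinM.
    rewrite ge0_integralZl//; last first.
      by apply/measurable_EFinP; exact: normr_measurable.
    rewrite -(fineK gabs).
  over.
  rewrite ge0_integralZr//; last 2 first.
    by apply/measurable_EFinP; exact: normr_measurable.
    by rewrite lee_fin fine_ge0// integral_ge0.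
  by rewrite fineK// ltey_eq fin_numM.
have ph : Q.-integrable setT (p \o h).
  apply/integrableP; split; first exact: measurableT_comp.
  have abs_ge0 : {in setT, forall z, (0 <= (abse \o p) z)%E}.
    by move=> z _; exact: abse_ge0.
  have /= <- := ge0_integral_pushforward mh Q measurableT mabs abs_ge0.
  by rewrite -[pushforward _ _]/(distribution Q hM) joint; case/integrableP: pi.
split; first exact: ph.
have /= <- := integral_pushforward mh (D := setT) mp ph measurableT.
rewrite -[pushforward _ _]/(distribution Q hM) joint -(integral12_prod_meas1 pi).
rewrite /fubini_F /p /=.
under eq_integral do under eq_integral do rewrite EFinM.
under eq_integral do rewrite integralZl// gE.
by rewrite integralZr// fE -EFinM.
Qed.

End IndependentProduct.

(** * One sample against all the others *)

Section MutualIndependence.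
Context (d d' : measure_display) (S : measurableType d) (E : measurableType d')
  (R : realType) (Q : probability S R) (I : finType) (Z : I -> S -> E).
Hypothesis mZ : forall k, measurable_fun setT (Z k).
Hypothesis indepZ : mutually_independent Q Z.

(** A pi-system generating the sigma-algebra of the samples other than the
    i-th.  Working with this sigma-algebra on S itself, instead of with a tuple
    of the remaining samples, lets a product such as x_j y_k y_l be handled
    without distinguishing which of j, k, l coincide. *)
Definition rest_cylinders (i : I) : set (set S) :=
  [set C | exists2 A : I -> set E, forall k, measurable (A k) &
    C = \bigcap_(k in [set` [set k | k != i]%SET]) (Z k @^-1` A k)].

Definition rest_measurable (i : I) (g : S -> R) : Prop :=
  measurable_fun [set: g_sigma_algebraType (rest_cylinders i)] g.

Lemma rest_cylinders_measurable i : rest_cylinders i `<=` measurable.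
Proof.
move=> _ [A mA ->]; apply: fin_bigcap_measurable => // k _.
by rewrite -[X in measurable X]setTI; exact: mZ.
Qed.

Lemma setI_closed_rest_cylinders i : setI_closed (rest_cylinders i).
Proof.
move=> _ _ [A mA ->] [B mB ->]; exists (fun k => A k `&` B k).
  by move=> k; exact: measurableI.
rewrite -bigcapI; apply: eq_bigcapr => k _.
by rewrite preimage_setI.
Qed.

Lemma rest_cylindersT i : rest_cylinders i setT.
Proof. by exists (fun=> setT) => //; apply/esym/seteqP; split. Qed.

(** The product rule is applied twice: to all indices with the event A at i, and
    to all indices but i. *)
Lemma indep_rest_cylinders i A C : measurable A -> rest_cylinders i C ->
  (Q (C `&` Z i @^-1` A) = Q (Z i @^-1` A) * Q C)%E.
Proof.
move=> mA [B mB ->].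
pose AB k := if k == i then A else B k.
have mAB k : measurable (AB k) by rewrite /AB; case: ifP.
have := indepZ [set: I]%SET mAB; rewrite (bigD1 i) ?inE//= {2}/AB eqxx.
have -> : \bigcap_(k in [set` [set: I]%SET]) (Z k @^-1` AB k) =
    (\bigcap_(k in [set` [set k | k != i]%SET]) (Z k @^-1` B k)) `&` Z i @^-1` A.
  apply/seteqP; split=> [w ABw | w [Bw Aw] k _].
    split=> [k /=|].
      rewrite inE => ki; have := ABw k.
      by rewrite /AB /= (negbTE ki); apply; rewrite inE.
    by have := ABw i; rewrite /AB /= eqxx; apply; rewrite inE.
  rewrite /AB /=; case: eqP => [->//|/eqP ki].
  by apply: Bw; rewrite /= inE.
move=> ->; congr (_ * _)%E.
rewrite (indepZ [set k | k != i]%SET mB).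
apply: eq_big => k; first by rewrite !inE.
by rewrite inE /AB => /negbTE ->.
Qed.

(** As functions of C, both sides are finite measures that agree on the
    pi-system of cylinders, hence on the sigma-algebra that it generates. *)
Lemma indep_rest i A C : measurable A -> <<s rest_cylinders i >> C ->
  (Q (C `&` Z i @^-1` A) = Q (Z i @^-1` A) * Q C)%E.
Proof.
move=> mA; have mZA : measurable (Z i @^-1` A).
  by rewrite -[X in measurable X]setTI; exact: mZ.
have pZA : 0 <= fine (Q (Z i @^-1` A)) by rewrite fine_ge0.
have [r {pZA} QZA] : exists r : {nonneg R}, Q (Z i @^-1` A) = r%:num%:E.
  by exists (NngNum pZA); rewrite /= fineK// fin_num_measure.
rewrite QZA.
apply: (g_sigma_algebra_measure_unique (rest_cylinders i)
  (@rest_cylinders_measurable i) (fun=> setT) (fun=> rest_cylindersT i) _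
  (mrestr Q mZA) (mscale r Q) (@setI_closed_rest_cylinders i)).
- by rewrite bigcup_const.
- by move=> B cB; have := indep_rest_cylinders mA cB; rewrite QZA.
- by move=> _; rewrite /= /mrestr setTI QZA ltry.
Qed.

Lemma rest_measurable_comp i k (f : E -> R) : k != i ->
  measurable_fun setT f -> rest_measurable i (f \o Z k).
Proof.
move=> ki mf _ B mB; rewrite setTI; apply: sub_sigma_algebra.
exists (fun j => if j == k then f @^-1` B else setT).
  by move=> j; case: eqP => // _; rewrite -[X in measurable X]setTI; exact: mf.
apply/seteqP; split=> [w fBw j _ /= | w /(_ k)].
  by case: eqP => [->|].
by rewrite /= inE eqxx; apply.
Qed.

Lemma has_mean_restM i (f : E -> R) (g : S -> R) (a b : R) :
  measurable_fun setT f -> rest_measurable i g ->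
  has_mean Q (f \o Z i) a -> has_mean Q g b ->
  has_mean Q (fun w => f (Z i w) * g w) (a * b).
Proof.
move=> mf mg; apply: has_mean_indepM => A B mA mB.
rewrite setIC comp_preimage indep_rest//.
  by rewrite -[X in measurable X]setTI; exact: mf.
by rewrite -[X in <<s _ >> X]setTI; exact: mg.
Qed.

Lemma rest_measurableM i (g h : S -> R) : rest_measurable i g ->
  rest_measurable i h -> rest_measurable i (fun w => g w * h w).
Proof. exact: measurable_funM. Qed.

End MutualIndependence.

(** * Mixed moments of centered samples *)

Definition kron (R : pzRingType) (I : eqType) (i j : I) : R := (i == j)%:R.

(** The mean of x_i x_j y_k y_l for centered pairs.  The first three terms are
    the pairings of Isserlis' formula, exact for jointly Gaussian pairs; when all
    four indices agree they add up to ab + 2c^2 and the last term restores m. *)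
Definition mixed_moment (R : pzRingType) (I : eqType) (a b c m : R)
    (i j k l : I) : R :=
  kron R i j * kron R k l * (a * b) + kron R i k * kron R j l * c ^+ 2
  + kron R i l * kron R j k * c ^+ 2
  + kron R i j * kron R j k * kron R k l * (m - a * b - 2 * c ^+ 2).

Section CenteredMoments.
Context (d d' : measure_display) (S : measurableType d) (E : measurableType d')
  (R : realType) (Q : probability S R) (I : finType) (Z : I -> S -> E).
Hypothesis mZ : forall k, measurable_fun setT (Z k).
Hypothesis indepZ : mutually_independent Q Z.
Variables (f g : E -> R) (a b c m : R).
Hypotheses (mf : measurable_fun setT f) (mg : measurable_fun setT g).

Local Notation x k w := (f (Z k w)).
Local Notation y k w := (g (Z k w)).

Hypothesis x_mean : forall k, has_mean Q (fun w => x k w) 0.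
Hypothesis y_mean : forall k, has_mean Q (fun w => y k w) 0.
Hypothesis xx_mean : forall k, has_mean Q (fun w => x k w ^+ 2) a.
Hypothesis yy_mean : forall k, has_mean Q (fun w => y k w ^+ 2) b.
Hypothesis xy_mean : forall k, has_mean Q (fun w => x k w * y k w) c.
Hypothesis xxyy_mean :
  forall k, has_mean Q (fun w => x k w ^+ 2 * y k w ^+ 2) m.

Let mx k : measurable_fun setT (f \o Z k).
Proof. exact: measurableT_comp. Qed.

Let my k : measurable_fun setT (g \o Z k).
Proof. exact: measurableT_comp. Qed.

Lemma has_mean_xy i k :
  has_mean Q (fun w => x i w * y k w) (kron R i k * c).
Proof.
rewrite /kron; have [<-|ik] := eqVneq i k; first by rewrite mul1r.
rewrite mul0r -[0](mul0r 0); apply: (has_mean_restM mZ indepZ mf _ (x_mean i)).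
  by apply: (rest_measurable_comp _ mg); rewrite eq_sym.
exact: y_mean.
Qed.

Lemma has_mean_xxyy_neq i k : i != k ->
  has_mean Q (fun w => x i w ^+ 2 * y k w ^+ 2) (a * b).
Proof.
move=> ik; have mff : measurable_fun setT (fun z => f z ^+ 2).
  exact: measurable_funX.
have mgg : measurable_fun setT (fun z => g z ^+ 2) by exact: measurable_funX.
apply: (has_mean_restM mZ indepZ mff _ (xx_mean i) (yy_mean k)).
by apply: (rest_measurable_comp _ mgg); rewrite eq_sym.
Qed.

Lemma has_mean_xxyy i k :
  exists e, has_mean Q (fun w => x i w ^+ 2 * y k w ^+ 2) e.
Proof.
by have [<-|/has_mean_xxyy_neq] := eqVneq i k; [exists m | exists (a * b)].
Qed.

(** Domination by x_i^2 y_k^2 + x_j^2. *)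
Lemma has_mean_xxy i j k :
  exists e, has_mean Q (fun w => x i w * x j w * y k w) e.
Proof.
have [e xxyy] := has_mean_xxyy i k.
apply: has_mean_dominated (has_meanD xxyy (xx_mean j)) => [|w].
  by apply: measurable_funM; [apply: measurable_funM; exact: mx | exact: my].
by rewrite ler_norml; apply/andP; split; nra.
Qed.

(** Domination by x_j^2 y_k^2 + y_l^2. *)
Lemma has_mean_xyy j k l :
  exists e, has_mean Q (fun w => x j w * (y k w * y l w)) e.
Proof.
have [e xxyy] := has_mean_xxyy j k.
apply: has_mean_dominated (has_meanD xxyy (yy_mean l)) => [|w].
  by apply: measurable_funM; [exact: mx | apply: measurable_funM; exact: my].
by rewrite ler_norml; apply/andP; split; nra.
Qed.

(** A centered factor independent of an integrable remainder annihilates the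
    mean, whatever the mean of the remainder is. *)
Lemma has_mean_isolated_x i j k l : j != i -> k != i -> l != i ->
  has_mean Q (fun w => x i w * (x j w * (y k w * y l w))) 0.
Proof.
move=> ji ki li; have [e xyy] := has_mean_xyy j k l.
rewrite -(mul0r e); apply: (has_mean_restM mZ indepZ mf _ (x_mean i) xyy).
apply: rest_measurableM; first exact: (rest_measurable_comp ji mf).
by apply: rest_measurableM; exact: (rest_measurable_comp _ mg).
Qed.

Lemma has_mean_isolated_y i j k l : i != l -> j != l -> k != l ->
  has_mean Q (fun w => y l w * (x i w * x j w * y k w)) 0.
Proof.
move=> il jl kl; have [e xxy] := has_mean_xxy i j k.
rewrite -(mul0r e); apply: (has_mean_restM mZ indepZ mg _ (y_mean l) xxy).
apply: rest_measurableM; last exact: (rest_measurable_comp kl mg).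
by apply: rest_measurableM; exact: (rest_measurable_comp _ mf).
Qed.

(** Either some index is isolated and the mean vanishes, or the four indices are
    all equal, or they form two disjoint pairs: {i, j} and {k, l} gives ab, and
    each of the two ways of pairing x-indices with y-indices gives c^2. *)
Lemma has_mean_mixed i j k l :
  has_mean Q (fun w => x i w * x j w * y k w * y l w)
    (mixed_moment a b c m i j k l).
Proof.
have mxy : measurable_fun setT (fun z => f z * g z) by exact: measurable_funM.
have pairs i' j' : i' != j' ->
    has_mean Q (fun w => x i' w * y i' w * (x j' w * y j' w)) (c * c).
  move=> ij; apply: (has_mean_restM mZ indepZ mxy _ (xy_mean i') (xy_mean j')).
  by apply: (rest_measurable_comp _ mxy); rewrite eq_sym.
rewrite /mixed_moment /kron.
have [<-{j}|ij] := eqVneq i j.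
  have [<-{l}|kl] := eqVneq k l.
    have [<-{k}|ik] := eqVneq i k.
      by apply: eq_has_mean (xxyy_mean i) => [w|] /=; ring.
    by apply: eq_has_mean (has_mean_xxyy_neq ik) => [w|] /=; ring.
  have [ik|ik] := eqVneq i k.
    have [il|il] := eqVneq i l; first by rewrite -ik il eqxx in kl.
    by apply: eq_has_mean (has_mean_isolated_y il il kl) => [w|] /=; ring.
  have lk : l != k by rewrite eq_sym.
  by apply: eq_has_mean (has_mean_isolated_y ik ik lk) => [w|] /=; ring.
have ji : j != i by rewrite eq_sym.
have [ik|ik] := eqVneq i k.
  subst k; rewrite (negbTE ji).
  have [<-{l}|jl] := eqVneq j l.
    by apply: eq_has_mean (pairs _ _ ij) => [w|] /=; ring.
  have lj : l != j by rewrite eq_sym.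
  by apply: eq_has_mean (has_mean_isolated_x ij ij lj) => [w|] /=; ring.
have ki : k != i by rewrite eq_sym.
have [il|il] := eqVneq i l.
  subst l; rewrite (negbTE ji).
  have [<-{k ik ki}|jk] := eqVneq j k.
    by apply: eq_has_mean (pairs _ _ ij) => [w|] /=; ring.
  have kj : k != j by rewrite eq_sym.
  by apply: eq_has_mean (has_mean_isolated_x ij kj ij) => [w|] /=; ring.
have li : l != i by rewrite eq_sym.
by apply: eq_has_mean (has_mean_isolated_x ji ki li) => [w|] /=; ring.
Qed.

End CenteredMoments.

(** * Sums of Kronecker deltas *)

Section KroneckerSums.
Context (R : comPzRingType) (N : nat).
Local Notation n := (N%:R : R).
Local Notation delta := (kron R).
Implicit Types (i j k l : 'I_N) (u v p q r s : R).

Lemma sum_kron i : \sum_(j < N) delta i j = 1.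
Proof.
rewrite (bigD1 i)//= /kron eqxx big1 ?addr0// => j ji.
by rewrite eq_sym (negbTE ji).
Qed.

Lemma sum_cst u : \sum_(i < N) u = n * u.
Proof. by rewrite sumr_const card_ord mulr_natl. Qed.

Lemma sum_kron2 u v :
  \sum_(i < N) \sum_(j < N) (delta i j * u + v) = n * u + n ^+ 2 * v.
Proof.
under eq_bigr do rewrite big_split/= -mulr_suml sum_kron sum_cst.
by rewrite sum_cst; ring.
Qed.

Lemma sum_kron3 p q r s :
  \sum_(i < N) \sum_(j < N) \sum_(k < N) (delta i j * p + delta j k * q
     + delta i k * r + delta i j * delta j k * s)
  = n ^+ 2 * (p + q + r) + n * s.
Proof.
transitivity (\sum_(i < N) \sum_(j < N) (delta i j * (n * p + s) + (q + r))).
  apply: eq_bigr => i _; apply: eq_bigr => j _.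
  rewrite !big_split/= sum_cst -!mulr_suml -mulr_sumr !sum_kron; ring.
by rewrite sum_kron2; ring.
Qed.

Lemma sum_kron4 p q r s :
  \sum_(i < N) \sum_(j < N) \sum_(k < N) \sum_(l < N)
    (delta i j * delta k l * p + delta i k * delta j l * q
     + delta i l * delta j k * r + delta i j * delta j k * delta k l * s)
  = n ^+ 2 * (p + q + r) + n * s.
Proof.
transitivity (\sum_(i < N) \sum_(j < N) \sum_(k < N) (delta i j * p
    + delta j k * r + delta i k * q + delta i j * delta j k * s)).
  apply: eq_bigr => i _; apply: eq_bigr => j _; apply: eq_bigr => k _.
  rewrite !big_split/= -!mulr_suml -!mulr_sumr !sum_kron; ring.
by rewrite sum_kron3; ring.
Qed.

End KroneckerSums.

(** * Translation invariance of the estimators *)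

Section ShiftInvariance.
Context (R : realType) (N : nat) (x y : 'I_N -> R) (s t : R).
Local Notation n := (N%:R : R).
Let x' k := x k - s.
Let y' k := y k - t.
Local Notation p := (power_sum x y).
Local Notation p' := (power_sum x' y').

Lemma power_sum_shift a b :
  p' a b = \sum_(i < a.+1) \sum_(j < b.+1)
    ((- s) ^+ i *+ 'C(a, i)) * ((- t) ^+ j *+ 'C(b, j)) * p (a - i) (b - j).
Proof.
under [RHS]eq_bigr do under eq_bigr do rewrite mulr_sumr.
under [RHS]eq_bigr do rewrite exchange_big.
rewrite exchange_big; apply: eq_bigr => k _ /=.
rewrite /x' /y' !exprDn mulr_suml; apply: eq_bigr => i _.
rewrite mulr_sumr; apply: eq_bigr => j _.
by rewrite -[_ *+ 'C(a, i)]mulr_natr -[_ *+ 'C(b, j)]mulr_natr; ring.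
Qed.

Lemma power_sum00 : p 0 0 = n.
Proof.
by rewrite /power_sum; under eq_bigr do rewrite mulr1; rewrite sum_cst mulr1.
Qed.

(** After the binomial expansion of the shifted power sums this is a polynomial
    identity in the power sums, s, t and n, which relies on p 0 0 = n. *)
Lemma cov_estimator_shift : cov_estimator x' y' = cov_estimator x y.
Proof.
rewrite /cov_estimator !power_sum_shift !big_ord_recl !big_ord0 /= !subnn !subn0.
rewrite power_sum00 /bump /= /binomial /=.
by congr (_ / _); ring.
Qed.

Lemma cov_variance_estimator_shift :
  cov_variance_estimator x' y' = cov_variance_estimator x y.
Proof.
rewrite /cov_variance_estimator !power_sum_shift !big_ord_recl !big_ord0 /=.
rewrite !subnn !subn0 power_sum00 /bump /= /binomial /=.
by congr (_ * _); ring.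
Qed.

End ShiftInvariance.

(** * Means of the estimators *)

Section EstimatorMoments.
Context (d : measure_display) (S : measurableType d) (R : realType)
  (Q : probability S R) (N : nat) (x y : 'I_N -> S -> R) (a b c m : R).
Hypothesis xy_mean : forall i k,
  has_mean Q (fun w => x i w * y k w) (kron R i k * c).
Hypothesis mixed_mean : forall i j k l,
  has_mean Q (fun w => x i w * x j w * y k w * y l w)
    (mixed_moment a b c m i j k l).
Local Notation n := (N%:R : R).
Local Notation p w := (power_sum (x ^~ w) (y ^~ w)).

(** In the lemmas below, a product of power sums is written as a sum of
    x_i x_j y_k y_l over the free indices, its moment formula is simplified to a
    combination of deltas by comparing indices, and the sum is evaluated. *)
Lemma has_mean_s11 : has_mean Q (fun w => p w 1 1) (n * c).
Proof.
apply: eq_has_mean (has_mean_sum (index_enum 'I_N) (fun i => xy_mean i i)) => //.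
by rewrite -sum_cst; apply: eq_bigr => i _; rewrite /kron eqxx mul1r.
Qed.

Lemma has_mean_s01_s10 : has_mean Q (fun w => p w 0 1 * p w 1 0) (n * c).
Proof.
apply: eq_has_mean (has_mean_sum (index_enum 'I_N) (fun i =>
    has_mean_sum (index_enum 'I_N) (xy_mean i))) => [w|] /=.
  rewrite [RHS]mulrC /power_sum mulr_suml; apply: eq_bigr => i _.
  by rewrite mulr_sumr; apply: eq_bigr => k _; ring.
have <- : n * c + n ^+ 2 * 0 = n * c by ring.
rewrite -sum_kron2.
by apply: eq_bigr => i _; apply: eq_bigr => k _; rewrite addr0.
Qed.

Lemma has_mean_s22 : has_mean Q (fun w => p w 2 2) (n * m).
Proof.
apply: eq_has_mean (has_mean_sum (index_enum 'I_N) (fun i =>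
    mixed_mean i i i i)) => [w|] /=.
  by apply: eq_bigr => i _ /=; ring.
rewrite -sum_cst; apply: eq_bigr => i _.
by rewrite /mixed_moment /kron eqxx /=; ring.
Qed.

Lemma has_mean_s11_s11 : has_mean Q (fun w => p w 1 1 ^+ 2)
  (n * (m - c ^+ 2) + n ^+ 2 * c ^+ 2).
Proof.
apply: eq_has_mean (has_mean_sum (index_enum 'I_N) (fun i =>
    has_mean_sum (index_enum 'I_N) (fun j => mixed_mean i j i j))) => [w|] /=.
  rewrite expr2 /power_sum mulr_suml; apply: eq_bigr => i _.
  by rewrite mulr_sumr; apply: eq_bigr => k _; ring.
rewrite -sum_kron2; apply: eq_bigr => i _; apply: eq_bigr => j _.
rewrite /mixed_moment /kron.
by case: (eqVneq i j) => [<-|_]; rewrite ?eqxx /=; ring.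
Qed.

Lemma has_mean_s10_s12 : has_mean Q (fun w => p w 1 0 * p w 1 2) (n * m).
Proof.
apply: eq_has_mean (has_mean_sum (index_enum 'I_N) (fun i =>
    has_mean_sum (index_enum 'I_N) (fun k => mixed_mean i k k k))) => [w|] /=.
  rewrite /power_sum mulr_suml; apply: eq_bigr => i _.
  by rewrite mulr_sumr; apply: eq_bigr => k _; ring.
have <- : n * m + n ^+ 2 * 0 = n * m by ring.
rewrite -sum_kron2.
apply: eq_bigr => i _; apply: eq_bigr => k _.
rewrite /mixed_moment /kron.
by case: (eqVneq i k) => [<-|_]; rewrite ?eqxx /=; ring.
Qed.

Lemma has_mean_s01_s21 : has_mean Q (fun w => p w 0 1 * p w 2 1) (n * m).
Proof.
apply: eq_has_mean (has_mean_sum (index_enum 'I_N) (fun i =>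
    has_mean_sum (index_enum 'I_N) (fun l => mixed_mean i i i l))) => [w|] /=.
  rewrite [RHS]mulrC /power_sum mulr_suml; apply: eq_bigr => i _.
  by rewrite mulr_sumr; apply: eq_bigr => l _; ring.
have <- : n * m + n ^+ 2 * 0 = n * m by ring.
rewrite -sum_kron2.
apply: eq_bigr => i _; apply: eq_bigr => l _.
by rewrite /mixed_moment /kron eqxx; case: (eqVneq i l) => _ /=; ring.
Qed.

Lemma has_mean_s02_s20 : has_mean Q (fun w => p w 0 2 * p w 2 0)
  (n * (m - a * b) + n ^+ 2 * (a * b)).
Proof.
apply: eq_has_mean (has_mean_sum (index_enum 'I_N) (fun i =>
    has_mean_sum (index_enum 'I_N) (fun k => mixed_mean i i k k))) => [w|] /=.
  rewrite [RHS]mulrC /power_sum mulr_suml; apply: eq_bigr => i _.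
  by rewrite mulr_sumr; apply: eq_bigr => k _; ring.
rewrite -sum_kron2; apply: eq_bigr => i _; apply: eq_bigr => k _.
rewrite /mixed_moment /kron.
by case: (eqVneq i k) => [<-|_]; rewrite ?eqxx /=; ring.
Qed.

Lemma has_mean_s02_s10_s10 : has_mean Q (fun w => p w 0 2 * p w 1 0 ^+ 2)
  (n ^+ 2 * (a * b) + n * (m - a * b)).
Proof.
apply: eq_has_mean (has_mean_sum (index_enum 'I_N) (fun i =>
    has_mean_sum (index_enum 'I_N) (fun j =>
    has_mean_sum (index_enum 'I_N) (fun k => mixed_mean i j k k)))) => [w|] /=.
  rewrite [RHS]mulrC expr2 -mulrA /power_sum mulr_suml; apply: eq_bigr => i _.
  rewrite mulr_suml mulr_sumr; apply: eq_bigr => j _.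
  by rewrite !mulr_sumr; apply: eq_bigr => k _; ring.
have ab : a * b + 0 + 0 = a * b by ring.
rewrite -{1}ab -sum_kron3.
apply: eq_bigr => i _; apply: eq_bigr => j _; apply: eq_bigr => k _.
rewrite /mixed_moment /kron; case: (eqVneq i j) => [<-{j}|ij]; rewrite ?eqxx.
  by case: (eqVneq i k) => _ /=; ring.
case: (eqVneq i k) => [<-{k}|ik] /=; last ring.
by rewrite eq_sym (negbTE ij) /=; ring.
Qed.

Lemma has_mean_s01_s01_s20 : has_mean Q (fun w => p w 0 1 ^+ 2 * p w 2 0)
  (n ^+ 2 * (a * b) + n * (m - a * b)).
Proof.
apply: eq_has_mean (has_mean_sum (index_enum 'I_N) (fun i =>
    has_mean_sum (index_enum 'I_N) (fun k =>
    has_mean_sum (index_enum 'I_N) (fun l => mixed_mean i i k l)))) => [w|] /=.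
  rewrite [RHS]mulrC expr2 /power_sum mulr_suml; apply: eq_bigr => i _.
  rewrite mulr_suml mulr_sumr; apply: eq_bigr => k _.
  by rewrite !mulr_sumr; apply: eq_bigr => l _; ring.
have ab : 0 + a * b + 0 = a * b by ring.
rewrite -{1}ab -sum_kron3.
apply: eq_bigr => i _; apply: eq_bigr => k _; apply: eq_bigr => l _.
rewrite /mixed_moment /kron eqxx; case: (eqVneq k l) => [<-{l}|kl].
  by case: (eqVneq i k) => _ /=; ring.
by case: (eqVneq i k) => [->|_] /=; rewrite ?(negbTE kl) /=; ring.
Qed.

Lemma has_mean_s01_s10_s11 : has_mean Q (fun w => p w 0 1 * (p w 1 0 * p w 1 1))
  (n ^+ 2 * c ^+ 2 + n * (m - c ^+ 2)).
Proof.
apply: eq_has_mean (has_mean_sum (index_enum 'I_N) (fun i =>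
    has_mean_sum (index_enum 'I_N) (fun j =>
    has_mean_sum (index_enum 'I_N) (fun l => mixed_mean i j j l)))) => [w|] /=.
  rewrite [RHS]mulrC /power_sum -mulrA mulr_suml; apply: eq_bigr => i _.
  rewrite mulr_suml mulr_sumr; apply: eq_bigr => j _.
  by rewrite !mulr_sumr; apply: eq_bigr => l _; ring.
have c2 : 0 + 0 + c ^+ 2 = c ^+ 2 by ring.
rewrite -{1}c2 -sum_kron3.
apply: eq_bigr => i _; apply: eq_bigr => j _; apply: eq_bigr => l _.
rewrite /mixed_moment /kron; case: (eqVneq i j) => [<-{j}|ij]; rewrite ?eqxx.
  by case: (eqVneq i l) => _ /=; ring.
by case: (eqVneq j l) => [<-|jl]; rewrite ?(negbTE ij) /=; ring.
Qed.

Lemma has_mean_s01_s01_s10_s10 :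
  has_mean Q (fun w => p w 0 1 ^+ 2 * p w 1 0 ^+ 2)
  (n ^+ 2 * (a * b + 2 * c ^+ 2) + n * (m - a * b - 2 * c ^+ 2)).
Proof.
apply: eq_has_mean (has_mean_sum (index_enum 'I_N) (fun i =>
    has_mean_sum (index_enum 'I_N) (fun j =>
    has_mean_sum (index_enum 'I_N) (fun k =>
    has_mean_sum (index_enum 'I_N) (fun l => mixed_mean i j k l))))) => [w|] /=.
  rewrite [RHS]mulrC !expr2 -mulrA /power_sum mulr_suml; apply: eq_bigr => i _.
  rewrite mulr_suml mulr_sumr; apply: eq_bigr => j _.
  rewrite mulr_suml !mulr_sumr; apply: eq_bigr => k _.
  by rewrite !mulr_sumr; apply: eq_bigr => l _; ring.
rewrite sum_kron4; ring.
Qed.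

Hypothesis N_gt3 : (3 < N)%N.

Let n0 : n != 0. Proof. by rewrite pnatr_eq0; case: N N_gt3. Qed.

Let n_neq (k : 'I_4) : n - k%:R != 0.
Proof.
by rewrite subr_eq0 eqr_nat gtn_eqF// (leq_ltn_trans _ N_gt3)// -ltnS.
Qed.

Let n1 : n - 1 != 0. Proof. exact: (n_neq (@Ordinal 4 1 isT)). Qed.
Let n2 : n - 2 != 0. Proof. exact: (n_neq (@Ordinal 4 2 isT)). Qed.
Let n3 : n - 3 != 0. Proof. exact: (n_neq (@Ordinal 4 3 isT)). Qed.

Local Notation h w := (cov_estimator (x ^~ w) (y ^~ w)).

Lemma has_mean_cov_estimator : has_mean Q (fun w => h w) c.
Proof.
apply: eq_has_mean (has_meanZ ((n - 1) * n)^-1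
  (has_meanB (has_meanZ n has_mean_s11) has_mean_s01_s10)) => [w|] /=.
  by rewrite /cov_estimator mulrC.
by field; rewrite n0 n1.
Qed.

Lemma has_mean_cov_variance_estimator :
  has_mean Q (fun w => cov_variance_estimator (x ^~ w) (y ^~ w))
  ((m + a * b / (n - 1) - (n - 2) / (n - 1) * c ^+ 2) / n).
Proof.
have bracket := has_meanZ n (has_meanD (has_meanD
    (has_meanZ (- n ^+ 2 + n + 2) has_mean_s11_s11)
    (has_meanZ ((n - 1) ^+ 2)
      (has_meanB (has_meanZ n has_mean_s22) (has_meanZ 2 has_mean_s10_s12))))
    (has_meanZ (n - 1) (has_meanB has_mean_s02_s10_s10 has_mean_s02_s20))).
have square := has_meanD (has_meanZ (6 - 4 * n) has_mean_s01_s01_s10_s10)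
    (has_meanZ ((n - 1) * n) has_mean_s01_s01_s20).
have cross := has_meanZ (2 * n)
    (has_meanD (has_meanZ ((n - 1) ^+ 2) has_mean_s01_s21)
               (has_meanZ (5 - 3 * n) has_mean_s01_s10_s11)).
apply: eq_has_mean (has_meanZ (1 / ((n - 3) * (n - 2) * (n - 1) ^+ 2 * n ^+ 2))
  (has_meanB (has_meanD bracket square) cross)) => [w|] /=.
  by rewrite /cov_variance_estimator; congr (_ * _); ring.
by field; rewrite n0 n1 n2 n3.
Qed.

(** The square of the covariance estimator involves only s11^2, s01 s10 s11 and
    s01^2 s10^2, whose means are known; in particular it is integrable although
    no fourth moment of a single component is assumed finite. *)
Lemma variance_cov_estimator : ('V_Q[fun w => h w] =
  ((m + a * b / (n - 1) - (n - 2) / (n - 1) * c ^+ 2) / n)%:E)%E.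
Proof.
have h2 := has_meanZ (((n - 1) * n) ^- 2) (has_meanD (has_meanB
  (has_meanZ (n ^+ 2) has_mean_s11_s11) (has_meanZ (2 * n) has_mean_s01_s10_s11))
  has_mean_s01_s01_s10_s10).
have h2' := eq_has_mean _ erefl h2.
rewrite (variance_has_mean has_mean_cov_estimator (h2' (fun w => h w ^+ 2) _)).
  by congr (_%:E); field; rewrite n0 n1.
by move=> w; rewrite /cov_estimator; field; rewrite n0 n1.
Qed.

End EstimatorMoments.

(** * Unbiasedness *)

(** The variance is taken around the finite part of the expectation, which is
    not known to be the mean before u is known to be integrable.  Finiteness of
    the second moment around that number, whatever it is, makes u integrable by
    |t| <= t^2 + 1, and then the number is the mean. *)
Lemma finite_variance_centered (d : measure_display) (S : measurableType d)
    (R : realType) (Q : probability S R) (u : {RV Q >-> R}) :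
  ('V_Q[u] < +oo)%E -> exists a,
    has_mean Q (fun w => u w - fine 'E_Q[u]%E) 0 /\
    has_mean Q (fun w => (u w - fine 'E_Q[u]%E) ^+ 2) a.
Proof.
set mu := fine _ => Vu.
have mu' : measurable_fun setT (fun w => u w - mu) by apply: measurable_funB.
have [a u2a] : exists a, has_mean Q (fun w => (u w - mu) ^+ 2) a.
  apply: has_mean_ge0_lty => [|w|]; first exact: (measurable_funX 2 mu').
    exact: sqr_ge0.
  by move: Vu; rewrite /variance unlock -/mu.
exists a; split=> //.
have [e ue] : exists e, has_mean Q u e.
  apply: has_mean_dominated (has_meanD u2a (has_mean_cst Q (`|mu| + 1))) => //.
  move=> w; rewrite addrA -[X in `|X|](subrK mu) (le_trans (ler_normD _ _))//.
  rewrite addrAC lerD2r -real_normK ?num_real//.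
  by have := sqr_ge0 (`|u w - mu| - 1); have := normr_ge0 (u w - mu); nra.
have -> : mu = e by rewrite /mu unlock; case: ue => _ ->.
by apply: eq_has_mean (has_meanB ue (has_mean_cst Q e)) => //; rewrite subrr.
Qed.

Theorem mainTheorem1 (R : realType)
    (d : measure_display) (T : measurableType d) (P : probability T R)
    (ui uj : {RV P >-> R})
    (var_ui : ('V_P[ui] < +oo)%E) (var_uj : ('V_P[uj] < +oo)%E)
    (mom22 : ('E_P[fun w => ((ui w - fine 'E_P[ui]) ^+ 2
                             * (uj w - fine 'E_P[uj]) ^+ 2)%R] < +oo)%E)
    (N : nat) (N_gt3 : (3 < N)%N)
    (d' : measure_display) (S : measurableType d') (Q : probability S R)
    (X Y : 'I_N -> {RV Q >-> R})
    (samples : independent_samples ui uj X Y) :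
  let h := fun w : S => cov_estimator (X ^~ w) (Y ^~ w) in
  let V := fun w : S => cov_variance_estimator (X ^~ w) (Y ^~ w) in
  unbiased_estimator Q V ('V_Q[h])%E.
Proof.
move=> h V.
have [a [x1 x2]] := finite_variance_centered var_ui.
have [b [y1 y2]] := finite_variance_centered var_uj.
set mu := fine 'E_P[ui]%E in mom22 x1 x2 *.
set nu := fine 'E_P[uj]%E in mom22 y1 y2 *.
have mx := has_mean_measurable x1; have my := has_mean_measurable y1.
have [m xy22] := has_mean_ge0_lty
  (measurable_funM (measurable_funX 2 mx) (measurable_funX 2 my))
  (fun w => mulr_ge0 (sqr_ge0 _) (sqr_ge0 _)) mom22.
have [c xy] : exists c, has_mean P (fun w => (ui w - mu) * (uj w - nu)) c.
  apply: has_mean_dominated (has_meanD x2 y2) => [|w].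
    exact: measurable_funM.
  move: (ui w - mu) (uj w - nu) => s t.
  by rewrite ler_norml; apply/andP; split; nra.
case: samples => same_laws indep.
pose f (z : R * R) := z.1 - mu; pose g (z : R * R) := z.2 - nu.
have mf : measurable_fun setT f by apply: measurable_funB.
have mg : measurable_fun setT g by apply: measurable_funB.
have mZ k : measurable_fun setT (rpair (X k) (Y k)).
  exact: measurable_fun_pair.
have mu' : measurable_fun setT (rpair ui uj) by exact: measurable_fun_pair.
have transfer (F : R * R -> R) e : measurable_fun setT F ->
    has_mean P (F \o rpair ui uj) e ->
    forall k, has_mean Q (F \o rpair (X k) (Y k)) e.
  by move=> mF Fe k; exact: has_mean_same_law (mZ k) mu' mF (same_laws k) Fe.
have ff := measurable_funX 2 mf; have gg := measurable_funX 2 mg.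
have X1 := transfer f 0 mf x1; have Y1 := transfer g 0 mg y1.
have X2 := transfer _ a ff x2; have Y2 := transfer _ b gg y2.
have XY := transfer _ c (measurable_funM mf mg) xy.
have XY22 := transfer _ m (measurable_funM ff gg) xy22.
have mean2 := has_mean_xy mZ indep mf mg X1 Y1 XY.
have mean4 := has_mean_mixed mZ indep mf mg X1 Y1 X2 Y2 XY XY22.
have <- : (fun w => cov_variance_estimator
    (fun k => X k w - mu) (fun k => Y k w - nu)) = V.
  by apply/funext => w; exact: cov_variance_estimator_shift.
have <- : (fun w => cov_estimator
    (fun k => X k w - mu) (fun k => Y k w - nu)) = h.
  by apply/funext => w; exact: cov_estimator_shift.
rewrite (variance_cov_estimator mean2 mean4 N_gt3).
exact: unbiased_has_mean (has_mean_cov_variance_estimator mean4 N_gt3).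
Qed.
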